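(* Let $A_k=\{0=a_0<a_1<\cdots<a_k\}$ be a restricted basis with range $n$. Let $i$ be an index with $0<i<k-1$, and let $j=k-1-i$. Then: (1) The prefix $A_i=\{a_0,\ldots,a_i\}$ is an admissible basis with $n_2(A_i)\ge a_k-n_2(j-1)-2$. (2) The mirrored suffix $B_j=a_k-\{a_{i+1},\ldots,a_k\}=\{a_k-a_{i+1},\ldots,a_k-a_k\}$ is an admissible basis with $n_2(B_j)\ge a_k-n_2(i-1)-2$. Here $n_2(m)$ denotes the maximum range among all bases of length $m$.
   Context: For a set of integers $A$, $2A=A+A=\{a+a': a,a'\in A\}$, and $[c,d]=\{c,\ldots,d\}$. A basis of length $m$ is a set of integers $A_m=\{0=a_0<a_1<\cdots<a_m\}$ (the element $0$ is not counted in the length). Its range $n_2(A_m)$ is the largest $n$ with $2A_m\supseteq[0,n]$. A basis is admissible if $n_2(A_m)\ge a_m$, and restricted if $n_2(A_m)\ge 2a_m$. For an integer $b$ and set $A$, $b-A=\{b-a:a\in A\}$. For $m\ge 0$, $n_2(m)$ is the maximum of $n_2(A_m)$ over all bases $A_m$ of length $m$ (so $n_2(0)=0$, the basis being $\{0\}$). *)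

(* Defs.v *)
From mathcomp Require Import all_boot all_order all_algebra.
From mathcomp Require Import boolp classical_sets set_interval.

Set Implicit Arguments.
Unset Strict Implicit.
Unset Printing Implicit Defensive.

Import Order.TTheory GRing.Theory Num.Theory.

Local Open Scope classical_set_scope.
Local Open Scope ring_scope.

(* Junk value 0 if [P] has no largest element; [largestP] below covers the
   other case, and [n2P], [n2_maxP] show that it is the only one used. *)
Definition largest (P : set nat) : nat :=
  xget 0%N [set n | P n /\ forall p, P p -> (p <= n)%N].

Definition sumset2 (A : set int) : set int := [set x + y | x in A & y in A].

Definition reflect_set (b : int) (A : set int) : set int :=
  [set b - x | x in A].

Definition covers (A : set int) (n : nat) : Prop :=
  `[0, n%:Z]%classic `<=` sumset2 A.

Definition n2 (A : set int) : nat := largest (covers A).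

(* [A = {0 = a 0 < a 1 < ... < a m}]; values of [a] beyond [m] are irrelevant. *)
Definition enumerates (m : nat) (a : nat -> int) (A : set int) : Prop :=
  [/\ a 0%N = 0,
      forall l, (l < m)%N -> a l < a l.+1
    & A = [set a l | l in [set l | (l <= m)%N]]].

Definition basis (m : nat) (A : set int) : Prop :=
  exists a, enumerates m a A.

Definition admissible (m : nat) (A : set int) : Prop :=
  exists2 a, enumerates m a A & a m <= (n2 A)%:Z.

Definition restricted (m : nat) (A : set int) : Prop :=
  exists2 a, enumerates m a A & 2 * a m <= (n2 A)%:Z.

Definition n2_max (m : nat) : nat :=
  largest [set r | exists2 A, basis m A & n2 A = r].

Lemma largestP (P : set nat) (b : nat) :
  P !=set0 -> (forall n, P n -> (n <= b)%N) ->
  P (largest P) /\ forall n, P n -> (n <= largest P)%N.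
Proof.
move=> [n0 Pn0] Pb.
have exP : exists n, `[< P n >] by exists n0; apply/asboolP.
have ubP n : `[< P n >] -> (n <= b)%N by move=> /asboolP /Pb.
case: (ex_maxnP exP ubP) => n /asboolP Pn maxn.
rewrite /largest; case: xgetP => [x _ //|/(_ n) []].
by split=> // p Pp; apply: maxn; apply/asboolP.
Qed.

Lemma covers_bound (m n : nat) (A : set int) :
  basis m A -> covers A n -> (n <= m.+1 * m.+1)%N.
Proof.
move=> [a [_ _ ->]] cov.
pose s := [seq a p + a q | p <- iota 0 m.+1, q <- iota 0 m.+1].
have <- : size s = (m.+1 * m.+1)%N by rewrite size_allpairs size_iota.
apply: (@leq_trans n.+1) => //.
rewrite -(size_iota 0 n.+1) -(size_map Posz).
apply: uniq_leq_size; first by rewrite map_inj_uniq ?iota_uniq // => x y [].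
move=> _ /mapP[x + ->]; rewrite mem_iota add0n ltnS => /= xn.
have /cov : `[0, n%:Z]%classic x%:Z by rewrite /= in_itv /= lez_nat xn.
move=> [_ [p /= pm <-]] [_ [q /= qm <-]] <-.
by apply: (allpairs_f (fun p q => a p + a q)); rewrite mem_iota.
Qed.

Lemma n2P (m : nat) (A : set int) : basis m A ->
  covers A (n2 A) /\ forall n, covers A n -> (n <= n2 A)%N.
Proof.
move=> bA; apply: (@largestP _ (m.+1 * m.+1)); last first.
  by move=> n; apply: covers_bound bA.
case: bA => a [a0 _ ->]; exists 0%N => x /=; rewrite in_itv /= => x0.
have -> : x = 0 by apply/eqP; rewrite eq_le andbC.
exists 0; first by exists 0%N.
by exists 0; [exists 0%N | rewrite addr0].
Qed.

Lemma n2_maxP (m : nat) :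
  (exists2 A, basis m A & n2 A = n2_max m) /\
  forall A, basis m A -> (n2 A <= n2_max m)%N.
Proof.
have [||wit ub] := @largestP [set r | exists2 A, basis m A & n2 A = r]
  (m.+1 * m.+1).
- exists (n2 [set Posz l | l in [set l | (l <= m)%N]]).
  exists [set Posz l | l in [set l | (l <= m)%N]] => //.
  by exists Posz; split=> // l _; rewrite ltz_nat.
- by move=> _ [A bA <-]; apply: covers_bound (bA) (n2P bA).1.
by split=> // A bA; apply: ub; exists A.
Qed.

Lemma n2_max0 : n2_max 0 = 0%N.
Proof.
case: (n2_maxP 0) => -[A bA <-] _; have [cov _] := n2P bA.
have : `[0, (n2 A)%:Z]%classic (n2 A)%:Z by rewrite /= in_itv /= !lexx.
move: (n2 A) cov => n + /[dup] _ xn => /(_ _ xn).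
case: bA => a [a0 _ ->] [_ [p /= + <-]] [_ [q /= + <-]].
rewrite !leqn0 => /eqP -> /eqP ->; rewrite a0 addr0.
by case.
Qed.

(* Main.v *)
Require Import Defs.
From mathcomp Require Import all_boot all_order all_algebra.
From mathcomp Require Import boolp classical_sets.
From mathcomp Require Import zify.
Import Order.TTheory GRing.Theory Num.Theory.
Local Open Scope classical_set_scope.
Local Open Scope ring_scope.

(** Numbers below [a (i+1)] can only be sums of elements of the prefix [A_i],
    so the range of [A_i] is at least [a (i+1) - 1].  The reflection [a k - A]
    is again restricted, and its prefixes are the mirrored suffixes of [A],
    which gives [n2 B_j >= a k - a i - 1].  The bound (1) on [A_i] is the first
    inequality at [i] combined with the second one at [i + 1], where the
    mirrored suffix has length [j - 1]; the bound (2) on [B_j] is the second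
    inequality at [i] combined with the first one at [i - 1]. *)

Lemma enumerates_le (k : nat) (a : nat -> int) (A : set int) (p q : nat) :
  enumerates k a A -> (p <= q)%N -> (q <= k)%N -> a p <= a q.
Proof.
move=> [_ inc _] + qk; elim: q qk => [|q IH] qk pq.
  by have -> : p = 0%N by lia.
have [->//|npq] := eqVneq p q.+1.
apply: (@le_trans _ _ (a q)); last by apply: ltW; apply: inc.
by apply: IH; lia.
Qed.

Lemma enumerates_prefix (k i : nat) (a : nat -> int) (A : set int) :
  enumerates k a A -> (i <= k)%N ->
  enumerates i a [set a l | l in [set l : nat | (l <= i)%N]].
Proof. by move=> [a0 inc _] ik; split=> // l li; apply: inc; lia. Qed.

Lemma n2_prefix (k N i : nat) (a : nat -> int) (A : set int) :
  enumerates k a A -> covers A N -> (i < k)%N -> a i.+1 <= N%:Z + 1 ->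
  a i.+1 - 1 <= (n2 [set a l | l in [set l : nat | (l <= i)%N]])%:Z.
Proof.
move=> eA cov ik aN; have [a0 inc defA] := eA.
have bP : basis i [set a l | l in [set l : nat | (l <= i)%N]].
  by exists a; apply: enumerates_prefix eA (ltnW ik).
have ai0 : 0 <= a i by rewrite -a0; apply: (enumerates_le _ _ _ _ _ eA); lia.
have aS := inc _ ik.
have -> : a i.+1 - 1 = (absz (a i.+1 - 1))%:Z by lia.
rewrite lez_nat; apply: (n2P bP).2 => x /=; rewrite in_itv /= => xm.
have /cov : `[0, N%:Z]%classic x by rewrite /= in_itv /=; lia.
have small p : (p <= k)%N -> a p < a i.+1 -> (p <= i)%N.
  by move=> pk; apply: contraTT; rewrite -ltnNge -leNgt => ip;
     apply: (enumerates_le _ _ _ _ _ eA).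
have pos p : (p <= k)%N -> 0 <= a p.
  by move=> pk; rewrite -a0; apply: (enumerates_le _ _ _ _ _ eA).
rewrite defA => -[_ [p /= pk <-]] [_ [q /= qk <-]] xE.
(* Both summands are nonnegative, so neither exceeds [x], which is below [a i.+1]; [small] then
   bounds both indices by [i]. *)
have := pos p pk; have := pos q qk => q0 p0.
by exists (a p); [exists p => //=; apply: small => //; lia|];
   exists (a q) => //; exists q => //=; apply: small => //; lia.
Qed.

Lemma admissible_prefix (k N i : nat) (a : nat -> int) (A : set int) :
  enumerates k a A -> covers A N -> (i < k)%N -> a i.+1 <= N%:Z + 1 ->
  admissible i [set a l | l in [set l : nat | (l <= i)%N]].
Proof.
move=> eA cov ik aN; exists a; first exact: enumerates_prefix eA (ltnW ik).
have := n2_prefix _ _ _ _ _ eA cov ik aN.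
by have [_ /(_ i ik) aS _] := eA; lia.
Qed.

(** The enumeration inside [restricted] is not given to be [a]. It suffices that its last term is at
    least [a k], which holds since [a k] is one of its terms. *)
Lemma restricted_covers (k : nat) (a : nat -> int) (A : set int) :
  enumerates k a A -> restricted k A -> covers A (absz (2 * a k)).
Proof.
move=> eA [b eB bA] x /=; rewrite in_itv /= => xb.
have [cov _] : covers A (n2 A) /\ forall n, covers A n -> (n <= n2 A)%N.
  by apply: (@n2P k); exists a.
apply: cov; rewrite /= in_itv /=.
have ak0 : 0 <= a k.
  by have [<- _ _] := eA; apply: (enumerates_le _ _ _ _ _ eA).
have [l lk abl] : [set b l | l in [set l : nat | (l <= k)%N]] (a k).
  have [_ _ <-] := eB; have [_ _ ->] := eA.
  by exists k => /=.
have := enumerates_le _ _ _ _ _ eB lk (leqnn k).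
lia.
Qed.

Lemma enumerates_reflect (k : nat) (a : nat -> int) (A : set int) :
  enumerates k a A ->
  enumerates k (fun l => a k - a (k - l)%N) (reflect_set (a k) A).
Proof.
move=> [a0 inc ->]; split.
- by rewrite subn0 subrr.
- move=> l lk; have := inc (k - l.+1)%N.
  by rewrite -subSn // subSS; lia.
apply/seteqP; split=> x /=.
  move=> [_ [l /= lk <-] <-]; exists (k - l)%N => /=; first by lia.
  by rewrite subKn.
move=> [l /= lk <-]; exists (a (k - l)%N) => //.
by exists (k - l)%N => //=; lia.
Qed.

(** Reflecting both summands of [N - x = p + q] gives [x = (b - p) + (b - q)], because [N = 2 * b].
    This is why the range is cut down to exactly [2 * a k]. *)
Lemma covers_reflect (N : nat) (b : int) (A : set int) :
  N%:Z = 2 * b -> covers A N -> covers (reflect_set b A) N.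
Proof.
move=> Nb cov x /=; rewrite in_itv /= => xN.
have /cov [p Ap [q Aq pq]] : `[0, N%:Z]%classic (N%:Z - x).
  by rewrite /= in_itv /=; lia.
by exists (b - p); [exists p | exists (b - q); [exists q | lia]].
Qed.

Lemma reflect_suffix (k i : nat) (a : nat -> int) : (i < k)%N ->
  reflect_set (a k) [set a l | l in [set l : nat | (i < l <= k)%N]] =
  [set a k - a (k - l)%N | l in [set l : nat | (l <= k - 1 - i)%N]].
Proof.
move=> ik; apply/seteqP; split=> x /=.
  move=> [_ [l /= lk <-] <-]; exists (k - l)%N => /=; first by lia.
  by rewrite subKn //; lia.
move=> [l /= lk <-]; exists (a (k - l)%N) => //.
by exists (k - l)%N => //=; lia.
Qed.

Theorem theorem6 (k n i j : nat) (A : set int) (a : nat -> int)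
    (hA : enumerates k a A) (hres : restricted k A) (hn : n2 A = n)
    (hi0 : (0 < i)%N) (hik : (i < k - 1)%N) (hj : j = (k - 1 - i)%N) :
  let Ai := [set a l | l in [set l : nat | (l <= i)%N]] in
  let Bj := reflect_set (a k) [set a l | l in [set l : nat | (i < l <= k)%N]] in
  (admissible i Ai /\ (n2 Ai)%:Z >= a k - (n2_max (j - 1))%:Z - 2) /\
  (admissible j Bj /\ (n2 Bj)%:Z >= a k - (n2_max (i - 1))%:Z - 2).
Proof.
move=> Ai Bj.
have ik : (i < k)%N by lia.
have jk : (j < k)%N by lia.
pose b l := a k - a (k - l)%N.
have {Bj}-> : Bj = [set b l | l in [set l : nat | (l <= j)%N]].
  by rewrite hj; apply: reflect_suffix.
have cov := restricted_covers _ _ _ hA hres.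
have a_le p q : (p <= q)%N -> (q <= k)%N -> a p <= a q.
  exact: enumerates_le hA.
have a_ge0 p : (p <= k)%N -> 0 <= a p.
  by move=> pk; have [<- _ _] := hA; apply: a_le.
have NE : (absz (2 * a k))%:Z = 2 * a k by have := a_ge0 k (leqnn k); lia.
have hB : enumerates k b (reflect_set (a k) A) := enumerates_reflect _ _ _ hA.
have covB := covers_reflect _ _ _ NE cov.
(* All terms of [a] and [b] lie between 0 and [a k], so they do not exceed the covered bound
   [2 * a k]. *)
have a_small l : (l < k)%N -> a l.+1 <= (absz (2 * a k))%:Z + 1.
  by move=> lk; rewrite NE; have := a_le l.+1 k lk (leqnn k);
     have := a_ge0 k (leqnn k); lia.
have b_small l : (l < k)%N -> b l.+1 <= (absz (2 * a k))%:Z + 1.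
  move=> lk; rewrite NE /b; have := a_ge0 (k - l.+1)%N (leq_subr _ _).
  by have := a_ge0 k (leqnn k); lia.
have n2_le (c : nat -> int) C l : enumerates k c C -> (l <= k)%N ->
    (n2 [set c p | p in [set p : nat | (p <= l)%N]] <= n2_max l)%N.
  move=> eC lk; apply: (n2_maxP l).2; exists c.
  exact: enumerates_prefix eC lk.
split; split.
- exact: admissible_prefix hA cov ik (a_small _ ik).
- have := n2_prefix _ _ _ _ _ hA cov ik (a_small _ ik).
  (* Since [j >= 1], the prefix of [b] of length [j - 1] yields [b j - 1 = a k - a i.+1 - 1 <=
     n2_max (j - 1)]. Adding [a i.+1 - 1 <= n2 Ai] cancels [a i.+1]; each inequality contributes 1
     to the final 2. *)
  have j1k : (j - 1 < k)%N by lia.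
  have := n2_prefix _ _ _ _ _ hB covB j1k (b_small _ j1k).
  have := n2_le _ _ _ hB (ltnW j1k).
  have -> : b (j - 1).+1 = a k - a i.+1 by congr (_ - a _); lia.
  by rewrite -/Ai; lia.
- exact: admissible_prefix hB covB jk (b_small _ jk).
- have := n2_prefix _ _ _ _ _ hB covB jk (b_small _ jk).
  (* Here [b j.+1 = a k - a i] because [k - (j + 1) = i], and, as [i >= 1], the prefix of [a] of
     length [i - 1] yields [a i - 1 <= n2_max (i - 1)]. *)
  have i1k : (i - 1 < k)%N by lia.
  have := n2_prefix _ _ _ _ _ hA cov i1k (a_small _ i1k).
  have := n2_le _ _ _ hA (ltnW i1k).
  have -> : (i - 1).+1 = i by lia.
  have -> : b j.+1 = a k - a i by congr (_ - a _); lia.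
  by move: (n2 _) (n2 _) (n2_max _) => u v w; lia.
Qed.
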